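(* Let $\mathcal W$ and $\mathcal U$ be universal Martin-Löf tests, and let $\mathcal A\subseteq 2^\omega$ be $\mathcal W$-layerwise semi-decidable. Then $\chi_{\mathcal A}\restriction\mathrm{MLR}\le_{\mathrm W}\mathsf{LAY}_{\mathcal U}$.
   Context: Cantor space $2^\omega$, Lebesgue measure $\lambda$. A sequence $(\mathcal U_i)_i$ of open subsets of $2^\omega$ is uniformly effectively open if $\{\langle i,\sigma\rangle:[\sigma]\subseteq\mathcal U_i\}$ is c.e. A Martin-Löf (ML) test is a uniformly effectively open sequence $(\mathcal V_i)_{i\in\omega}$ with $\lambda(\mathcal V_i)\le 2^{-i}$; it is universal if $\bigcap_i\mathcal V'_i\subseteq\bigcap_i\mathcal V_i$ for every ML-test $\mathcal V'$. $\mathrm{MLR}$ is the set of Martin-Löf random sequences. For universal $\mathcal W$, a set $\mathcal A\subseteq 2^\omega$ is $\mathcal W$-layerwise semi-decidable if there is a uniformly effectively open sequence $(\mathcal U'_i)_i$ with $\mathcal A\cap(2^\omega\setminus\mathcal W_i)=\mathcal U'_i\cap(2^\omega\setminus\mathcal W_i)$ for all $i$. $\chi_{\mathcal A}$ is the characteristic function, valued in $\{0,1\}\subseteq\omega$. A representation of a set $X$ is a surjective partial map $\delta_X:\subseteq\omega^\omega\to X$. A realizer of a multi-valued partial function $f:\subseteq X\rightrightarrows Y$ is a partial $\Gamma:\subseteq\omega^\omega\to\omega^\omega$ with $\delta_Y(\Gamma(p))\in f(\delta_X(p))$ for all $p\in\mathrm{dom}(f\circ\delta_X)$. $f\le_{\mathrm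 W} g$ if there are Turing functionals $\Phi,\Psi$ such that $p\mapsto\Psi(\langle p,\Gamma(\Phi(p))\rangle)$ realizes $f$ for every realizer $\Gamma$ of $g$. $\mathrm{MLR}$ is represented by the identity on $\mathrm{MLR}\subseteq\omega^\omega$, $\omega$ by $\chi_{\{n\}}\mapsto n$. $\mathsf{LAY}_{\mathcal U}\colon\mathrm{MLR}\rightrightarrows\omega$, $\mathsf{LAY}_{\mathcal U}(X)=\{i:X\notin\mathcal U_i\}$. *)

(* Defs.v *)
From Stdlib Require Import Arith List Lia.
Import ListNotations.

Inductive code : Type :=
| Zero : code
| Succ : code
| Proj : nat -> code
| Oracle : code
| Comp : code -> list code -> code
| Prim : code -> code -> code
| Mu : code -> code.

Inductive eval (p : nat -> nat) : code -> list nat -> nat -> Prop :=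
| e_zero args : eval p Zero args 0
| e_succ x args : eval p Succ (x :: args) (S x)
| e_proj i args : i < length args -> eval p (Proj i) args (nth i args 0)
| e_orac x args : eval p Oracle (x :: args) (p x)
| e_comp f gs args ys v :
    evals p gs args ys -> eval p f ys v -> eval p (Comp f gs) args v
| e_prim0 f g args v : eval p f args v -> eval p (Prim f g) (0 :: args) v
| e_primS f g n args r v :
    eval p (Prim f g) (n :: args) r -> eval p g (n :: r :: args) v ->
    eval p (Prim f g) (S n :: args) v
| e_mu f args n :
    eval p f (n :: args) 0 ->
    (forall m, m < n -> exists v, v <> 0 /\ eval p f (m :: args) v) ->
    eval p (Mu f) args n
with evals (p : nat -> nat) : list code -> list nat -> list nat -> Prop :=
| es_nil args : evals p nil args nil
| es_cons g gs args y ys :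
    eval p g args y -> evals p gs args ys -> evals p (g :: gs) args (y :: ys).

Definition tf (c : code) (p q : nat -> nat) : Prop :=
  forall n, eval p c [n] (q n).

Definition ce (S : nat -> Prop) : Prop :=
  exists c : code, forall n, S n <-> exists v, eval (fun _ => 0) c [n] v.

Definition cpair (i j : nat) : nat := (i + j) * (i + j + 1) / 2 + j.

(** Bijective coding of binary strings by natural numbers. *)
Fixpoint code_str (s : list bool) : nat :=
  match s with
  | nil => 0
  | b :: s' => 2 * code_str s' + (if b then 2 else 1)
  end.

Definition pairseq (p q : nat -> nat) : nat -> nat :=
  fun n => if Nat.even n then p (Nat.div2 n) else q (Nat.div2 n).

Definition cantor := nat -> bool.

Definition cyl (s : list bool) (X : cantor) : Prop :=
  forall k, k < length s -> X k = nth k s false.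

Definition isOpen (U : cantor -> Prop) : Prop :=
  forall X, U X -> exists n, forall Y, (forall k, k < n -> Y k = X k) -> U Y.

Definition unif_eff_open (U : nat -> cantor -> Prop) : Prop :=
  (forall i, isOpen (U i)) /\
  ce (fun n => exists i s, n = cpair i (code_str s) /\
                          forall X, cyl s X -> U i X).

(** Lebesgue measure: for a finite list L of strings of length <= N, the
    measure of the union of their cylinders is
    #{tau in 2^N | some sigma in L is a prefix of tau} / 2^N.  For an open
    set U, lambda(U) is the supremum of the measures of finite unions of
    cylinders contained in U. *)
Fixpoint all_strings (N : nat) : list (list bool) :=
  match N with
  | 0 => [nil]
  | S N' => map (cons false) (all_strings N') ++ map (cons true) (all_strings N')
  end.

Definition prefixb (s t : list bool) : bool :=
  if list_eq_dec Bool.bool_dec (firstn (length s) t) s then true else false.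

Definition count_cover (L : list (list bool)) (N : nat) : nat :=
  length (filter (fun t => existsb (fun s => prefixb s t) L) (all_strings N)).

(** lambda(U) <= 2^-i, for U open. *)
Definition meas_le_pow (U : cantor -> Prop) (i : nat) : Prop :=
  forall (L : list (list bool)) (N : nat),
    (forall s, In s L -> (forall X, cyl s X -> U X) /\ length s <= N) ->
    count_cover L N * 2 ^ i <= 2 ^ N.

Definition ML_test (V : nat -> cantor -> Prop) : Prop :=
  unif_eff_open V /\ forall i, meas_le_pow (V i) i.

Definition universal_ML_test (V : nat -> cantor -> Prop) : Prop :=
  ML_test V /\
  forall V', ML_test V' -> forall X, (forall i, V' i X) -> forall i, V i X.

Definition MLR (X : cantor) : Prop :=
  forall V, ML_test V -> ~ (forall i, V i X).

Definition layerwise_semidec (W : nat -> cantor -> Prop) (A : cantor -> Prop)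
  : Prop :=
  exists U' : nat -> cantor -> Prop, unif_eff_open U' /\
    forall i X, ~ W i X -> (A X <-> U' i X).

(** A representation is given as a relation [delta p x] ("p is a name of x"),
    assumed to be a partial surjection. Multi-valued partial functions
    f :⊆ X ⇉ Y are relations [F x y] ("y ∈ f(x)"), with dom f = {x | f(x) ≠ ∅}. *)

(** R (a functional relation, i.e. a partial map on Baire space) realizes F. *)
Definition realizes_rel {X Y : Type}
  (dX : (nat -> nat) -> X -> Prop) (dY : (nat -> nat) -> Y -> Prop)
  (F : X -> Y -> Prop) (R : (nat -> nat) -> (nat -> nat) -> Prop) : Prop :=
  forall p x, dX p x -> (exists y, F x y) ->
    exists q, R p q /\ exists y, dY q y /\ F x y.

Definition realizes {X Y : Type}
  (dX : (nat -> nat) -> X -> Prop) (dY : (nat -> nat) -> Y -> Prop)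
  (F : X -> Y -> Prop) (Gamma : (nat -> nat) -> option (nat -> nat)) : Prop :=
  realizes_rel dX dY F (fun p q => Gamma p = Some q).

Definition weihrauch_le {X Y Z V : Type}
  (dX : (nat -> nat) -> X -> Prop) (dY : (nat -> nat) -> Y -> Prop)
  (F : X -> Y -> Prop)
  (dZ : (nat -> nat) -> Z -> Prop) (dV : (nat -> nat) -> V -> Prop)
  (G : Z -> V -> Prop) : Prop :=
  exists Phi Psi : code,
    forall Gamma, realizes dZ dV G Gamma ->
      realizes_rel dX dY F
        (fun p r => exists p' q, tf Phi p p' /\ Gamma p' = Some q /\
                                 tf Psi (pairseq p q) r).

Definition b2n (b : bool) : nat := if b then 1 else 0.
Definition delta_MLR (p : nat -> nat) (X : cantor) : Prop :=
  MLR X /\ forall n, p n = b2n (X n).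

Definition delta_nat (p : nat -> nat) (n : nat) : Prop :=
  forall m, p m = (if Nat.eqb m n then 1 else 0).

Definition chi_MLR (A : cantor -> Prop) (X : cantor) (n : nat) : Prop :=
  MLR X /\ ((A X /\ n = 1) \/ (~ A X /\ n = 0)).

Definition LAY (U : nat -> cantor -> Prop) (X : cantor) (i : nat) : Prop :=
  MLR X /\ ~ U i X.

(* Main.v *)
Require Import Defs.
From Stdlib Require Import Bool Arith List Lia Classical ConstructiveEpsilon.
From Stdlib Require Import FunctionalExtensionality.
From Stdlib Require Cantor.
Import ListNotations.
Local Open Scope bool_scope.
Local Arguments Nat.sub : simpl never.

(** Given random [X], run through phases [0, 1, 2, ...], where phase [2j] ends
    when [X] is seen to enter [U' j] or [W j], and phase [2j + 1] ends when [X]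
    is seen to enter [W j].  Since [X] lies outside some [W j], the phase
    stabilizes, and the parity of its limit is the value of the characteristic
    function of [A] at [X].  It remains to bound the stage of the last change.
    The query [X'] copies [X]; when the phase changes at stage [n], after a
    prefix [rho] of length [n] has been written, enough zeros are appended to
    force [X'] into every [U i] with [i <= n], and the copying of [X] restarts.
    This is possible because [rho 000...] is computable, hence not random,
    hence in all [U i] by universality.  There are finitely many changes, so
    [X'] is a finite string followed by [X] and therefore random, and any [i]
    with [X'] outside [U i] bounds the stage of the last change. *)

(** * Computable functions on contexts *)

(** A point of a context provides an oracle and the arguments of a program, so
    that [recf C F] says that one program computes [F] on all points. *)
Record ctx := Ctx {
  pt :> Type;
  orc : pt -> nat -> nat;
  vars : pt -> list nat;
  arity : nat;
  length_vars : forall x, length (vars x) = arity }.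

Arguments orc {c} _ _.
Arguments vars {c} _.

Definition recf (C : ctx) (F : C -> nat) : Prop :=
  exists c, forall x, eval (orc x) c (vars x) (F x).

(** The new variable goes to the front of the arguments, where [Mu] puts its candidate and [Prim]
    its counter. *)
Definition ext (C : ctx) : ctx.
Proof.
  refine {| pt := C * nat; orc := fun y => orc (fst y);
            vars := fun y => snd y :: vars (fst y); arity := S (arity C) |}.
  intros [x n]; simpl; now rewrite length_vars.
Defined.

Lemma recf_ext {C : ctx} {F} (G : C -> nat) :
  recf C G -> (forall x, F x = G x) -> recf C F.
Proof. intros [c Hc] H; exists c; intros x; rewrite H; apply Hc. Qed.

Lemma evals_recf (C : ctx) (Fs : list (C -> nat)) :
  Forall (recf C) Fs ->
  exists gs, forall x, evals (orc x) gs (vars x) (map (fun F => F x) Fs).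
Proof.
  induction 1 as [|F Fs [c Hc] _ [gs Hgs]].
  - exists nil; intros; constructor.
  - exists (c :: gs); intros; simpl; now constructor.
Qed.

(** A [Comp] of the program for [G] with programs for the entries of [vars (h x)]. The oracles must
    agree because [Comp] passes its oracle on unchanged. *)
Lemma recf_subst (C D : ctx) (h : C -> D) (G : D -> nat) :
  (forall x, orc (h x) = orc x) ->
  (forall i, i < arity D -> recf C (fun x => nth i (vars (h x)) 0)) ->
  recf D G -> recf C (fun x => G (h x)).
Proof.
  intros Ho Hv [c Hc].
  destruct (evals_recf C (map (fun i x => nth i (vars (h x)) 0) (seq 0 (arity D))))
    as [gs Hgs].
  - apply Forall_forall; intros F HF; apply in_map_iff in HF.
    destruct HF as [i [<- Hi]]; apply in_seq in Hi; apply Hv; lia.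
  - exists (Comp c gs); intros x.
    apply e_comp with (vars (h x)); [|rewrite <- Ho; apply Hc].
    replace (vars (h x)) with
      (map (fun F : C -> nat => F x)
         (map (fun i x => nth i (vars (h x)) 0) (seq 0 (arity D)))); [apply Hgs|].
    rewrite map_map, <- (length_vars D (h x)).
    apply nth_ext with 0 0; rewrite length_map, length_seq; [easy|].
    intros n Hn.
    rewrite nth_indep with (d' := nth 0 (vars (h x)) 0)
      by now rewrite length_map, length_seq.
    rewrite (map_nth (fun i => nth i (vars (h x)) 0)).
    now rewrite seq_nth.
Qed.

Lemma recf_nth (C : ctx) i : i < arity C -> recf C (fun x => nth i (vars x) 0).
Proof. intros Hi; exists (Proj i); intros x; apply e_proj; now rewrite length_vars. Qed.

Lemma recf_weak1 (C : ctx) F : recf C F -> recf (ext C) (fun y => F (fst y)).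
Proof.
  apply (recf_subst (ext C) C fst); [easy|]; intros i Hi.
  apply (recf_nth (ext C) (S i)); simpl; lia.
Qed.

Lemma recf_weak2 (C : ctx) F : recf C F -> recf (ext (ext C)) (fun y => F (fst (fst y))).
Proof. intros H; exact (recf_weak1 _ _ (recf_weak1 _ _ H)). Qed.

Lemma recf_weak3 (C : ctx) F :
  recf C F -> recf (ext (ext (ext C))) (fun y => F (fst (fst (fst y)))).
Proof. intros H; exact (recf_weak1 _ _ (recf_weak2 _ _ H)). Qed.

Lemma recf_var0 (C : ctx) : recf (ext C) (fun y => snd y).
Proof. apply (recf_nth (ext C) 0); simpl; lia. Qed.

Lemma recf_var1 (C : ctx) : recf (ext (ext C)) (fun y => snd (fst y)).
Proof. apply (recf_nth (ext (ext C)) 1); simpl; lia. Qed.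

Lemma recf_var2 (C : ctx) : recf (ext (ext (ext C))) (fun y => snd (fst (fst y))).
Proof. apply (recf_nth (ext (ext (ext C))) 2); simpl; lia. Qed.

(** Computability of a function that varies with the point, such as the oracle or a function derived
    from it; its argument becomes one more variable. *)
Definition orecf (C : ctx) (P : C -> nat -> nat) : Prop :=
  recf (ext C) (fun y => P (fst y) (snd y)).

Lemma recf_app (C : ctx) P F : orecf C P -> recf C F -> recf C (fun x => P x (F x)).
Proof.
  intros HP HF.
  apply (recf_subst C (ext C) (fun x => (x, F x)) (fun y => P (fst y) (snd y)));
    [easy| |exact HP].
  intros [|i] Hi; simpl; [exact HF|]; apply recf_nth; simpl in Hi; lia.
Qed.

Lemma orecf_weak (C : ctx) P : orecf C P -> orecf (ext C) (fun y => P (fst y)).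
Proof.
  apply (recf_subst (ext (ext C)) (ext C) (fun y => (fst (fst y), snd y))
           (fun y => P (fst y) (snd y))); [easy|].
  intros [|i] Hi; [apply recf_var0|].
  apply (recf_nth (ext (ext C)) (S (S i))); simpl in *; lia.
Qed.

Lemma recf_orc (C : ctx) : orecf C orc.
Proof. exists Oracle; intros x; apply e_orac. Qed.

Lemma recf_S (C : ctx) F : recf C F -> recf C (fun x => S (F x)).
Proof.
  apply (recf_app C (fun _ n => S n)).
  exists Succ; intros x; apply e_succ.
Qed.

Lemma recf_const (C : ctx) k : recf C (fun _ => k).
Proof.
  induction k as [|k IH]; [|now apply recf_S].
  exists Zero; intros; apply e_zero.
Qed.

(** In the extended context [snd y] is the counter and [snd (fst y)] the previous value, the order
    in which [Prim] passes them. *)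
Lemma recf_nat (C : ctx) N F G :
  recf C N -> recf C F ->
  recf (ext (ext C)) (fun y => G (fst (fst y)) (snd y) (snd (fst y))) ->
  recf C (fun x => nat_rect (fun _ => nat) (F x) (G x) (N x)).
Proof.
  intros HN [f Hf] [g Hg].
  apply (recf_app C (fun x => nat_rect (fun _ => nat) (F x) (G x))); [|exact HN].
  exists (Prim f g); intros [x n]; simpl.
  induction n as [|n IH]; simpl; [apply e_prim0, Hf|].
  eapply e_primS; [exact IH|].
  exact (Hg ((x, _), n)).
Qed.

Lemma recf_pred (C : ctx) F : recf C F -> recf C (fun x => pred (F x)).
Proof.
  intros HF; apply (recf_ext (fun x => nat_rect (fun _ => nat) 0 (fun n _ => n) (F x))).
  - apply recf_nat; [exact HF|apply recf_const|apply recf_var0].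
  - intros x; now destruct (F x).
Qed.

(* Arithmetic, bounded quantifiers and unbounded search *)
Create HintDb recdb.
#[local] Hint Resolve recf_weak1 recf_weak2 recf_weak3 recf_var0 recf_var1 recf_var2
  recf_const recf_S recf_pred orecf_weak : recdb.

Lemma recf_add (C : ctx) F G : recf C F -> recf C G -> recf C (fun x => F x + G x).
Proof.
  intros HF HG.
  apply (recf_ext (fun x => nat_rect (fun _ => nat) (G x) (fun _ r => S r) (F x))).
  - apply recf_nat; auto with recdb.
  - intros x; induction (F x); simpl; congruence.
Qed.
#[local] Hint Resolve recf_add : recdb.

Lemma recf_sub (C : ctx) F G : recf C F -> recf C G -> recf C (fun x => F x - G x).
Proof.
  intros HF HG.
  apply (recf_ext (fun x => nat_rect (fun _ => nat) (F x) (fun _ r => pred r) (G x))).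
  - apply recf_nat; auto with recdb.
  - intros x; induction (G x); simpl; lia.
Qed.
#[local] Hint Resolve recf_sub : recdb.

Lemma recf_mul (C : ctx) F G : recf C F -> recf C G -> recf C (fun x => F x * G x).
Proof.
  intros HF HG.
  apply (recf_ext (fun x => nat_rect (fun _ => nat) 0 (fun _ r => G x + r) (F x))).
  - apply (recf_nat C F _ (fun x _ r => G x + r)); auto with recdb.
  - intros x; induction (F x); simpl; congruence.
Qed.
#[local] Hint Resolve recf_mul : recdb.

Lemma recf_pow2 (C : ctx) F : recf C F -> recf C (fun x => 2 ^ F x).
Proof.
  intros HF.
  apply (recf_ext (fun x => nat_rect (fun _ => nat) 1 (fun _ r => 2 * r) (F x))).
  - apply (recf_nat C F _ (fun x _ r => 2 * r)); auto with recdb.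
  - intros x; induction (F x); simpl in *; lia.
Qed.
#[local] Hint Resolve recf_pow2 : recdb.

(** Tests are numbers, with nonzero for true: [bsum] serves as bounded existential quantifier,
    [bprod] as bounded universal quantifier, and multiplication as conjunction. *)
Definition bsum (n : nat) (f : nat -> nat) : nat :=
  nat_rect (fun _ => nat) 0 (fun k r => r + f k) n.

Definition bprod (n : nat) (f : nat -> nat) : nat :=
  nat_rect (fun _ => nat) 1 (fun k r => r * f k) n.

Lemma bsum_neq0 n f : bsum n f <> 0 <-> exists k, k < n /\ f k <> 0.
Proof.
  induction n as [|n IH]; simpl.
  - split; [easy|intros [k [Hk _]]; lia].
  - fold (bsum n f); split.
    + intros H; destruct (Nat.eq_dec (f n) 0) as [E|E].
      * destruct (proj1 IH) as [k [Hk Ek]]; [lia|exists k; auto].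
      * exists n; auto.
    + intros [k [Hk Ek]]; destruct (Nat.eq_dec k n) as [->|Hn]; [lia|].
      enough (bsum n f <> 0) by lia.
      apply IH; exists k; split; [lia|easy].
Qed.

Lemma bsum_ext n f g : (forall k, f k = g k) -> bsum n f = bsum n g.
Proof. intros H; unfold bsum; induction n as [|n IH]; simpl; congruence. Qed.

Lemma bprod_neq0 n f : bprod n f <> 0 <-> forall k, k < n -> f k <> 0.
Proof.
  induction n as [|n IH]; simpl.
  - split; [lia|easy].
  - fold (bprod n f); rewrite <- Nat.neq_mul_0, IH; split.
    + intros [H1 H2] k Hk; destruct (Nat.eq_dec k n) as [->|Hn]; [easy|].
      apply H1; lia.
    + intros H; split; [intros k Hk|]; apply H; lia.
Qed.

Lemma recf_bsum (C : ctx) N f :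
  recf C N -> orecf C f -> recf C (fun x => bsum (N x) (f x)).
Proof.
  intros HN Hf; apply (recf_nat C N _ (fun x k r => r + f x k)); auto with recdb.
  apply recf_add; [apply recf_var1|exact (orecf_weak _ _ Hf)].
Qed.

Lemma recf_bprod (C : ctx) N f :
  recf C N -> orecf C f -> recf C (fun x => bprod (N x) (f x)).
Proof.
  intros HN Hf; apply (recf_nat C N _ (fun x k r => r * f x k)); auto with recdb.
  apply recf_mul; [apply recf_var1|exact (orecf_weak _ _ Hf)].
Qed.

#[local] Hint Resolve recf_bsum recf_bprod : recdb.
#[local] Hint Extern 5 (orecf _ _) => (unfold orecf; cbv beta) : recdb.

Definition eqt (a b : nat) : nat := 1 - ((a - b) + (b - a)).

Lemma eqt_neq0 a b : eqt a b <> 0 <-> a = b.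
Proof. unfold eqt; lia. Qed.

Lemma recf_eqt (C : ctx) F G : recf C F -> recf C G -> recf C (fun x => eqt (F x) (G x)).
Proof. intros; unfold eqt; auto 6 with recdb. Qed.

Lemma cpair_Cantor i j : cpair i j = Cantor.to_nat (i, j).
Proof.
  unfold cpair; apply Nat.mul_cancel_r with 2; [easy|].
  rewrite Cantor.to_nat_spec, Nat.mul_add_distr_r.
  (* A product of consecutive numbers is even, so the division in [cpair] is exact. *)
  assert (H : exists k, (i + j) * (i + j + 1) = k * 2).
  { generalize (i + j); intros n; induction n as [|n [k IH]]; [now exists 0|].
    exists (k + S n); lia. }
  destruct H as [k H]; rewrite H, Nat.div_mul by easy; lia.
Qed.

Lemma cpair_inj i j i' j' : cpair i j = cpair i' j' -> i = i' /\ j = j'.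
Proof.
  rewrite !cpair_Cantor; intros H.
  apply (f_equal Cantor.of_nat) in H; rewrite !Cantor.cancel_of_to in H.
  now injection H.
Qed.

Lemma cpair_ge i j : i + j <= cpair i j.
Proof. rewrite cpair_Cantor; pose proof (Cantor.to_nat_non_decreasing i j); lia. Qed.

Lemma recf_cpair (C : ctx) F G :
  recf C F -> recf C G -> recf C (fun x => cpair (F x) (G x)).
Proof.
  intros HF HG.
  (* The triangular number is computed as a sum, which avoids division. *)
  apply (recf_ext (fun x => G x + bsum (G x + F x) (fun i => S i))).
  - auto 7 with recdb.
  - intros x; rewrite cpair_Cantor; unfold Cantor.to_nat; f_equal.
    induction (G x + F x) as [|n IH]; [easy|]; simpl in *; rewrite IH; lia.
Qed.
#[local] Hint Resolve recf_eqt recf_cpair : recdb.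

(** Being nonzero is decidable, so a mere existence statement yields an actual number; search
    results can then be defined as functions. *)
Lemma least_nonzero (f : nat -> nat) : (exists w, f w <> 0) ->
  {w | f w <> 0 /\ forall v, f v <> 0 -> w <= v}.
Proof.
  intros H; apply epsilon_smallest; [|exact H].
  intros n; destruct (Nat.eq_dec (f n) 0); [right|left]; auto.
Qed.

(** [Mu] looks for a zero, and [1 - f] vanishes exactly where [f] does not. *)
Lemma eval_mu p c args f w :
  (forall m, eval p c (m :: args) (1 - f m)) ->
  f w <> 0 -> (forall v, f v <> 0 -> w <= v) -> eval p (Mu c) args w.
Proof.
  intros Hc Hw Hmin; apply e_mu.
  - specialize (Hc w); now replace (1 - f w) with 0 in Hc by lia.
  - intros m Hm; exists (1 - f m); split; [|exact (Hc m)].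
    enough (f m = 0) by lia.
    destruct (Nat.eq_dec (f m) 0) as [E|E]; [easy|]; apply Hmin in E; lia.
Qed.

Lemma recf_mu (C : ctx) G M :
  orecf C G -> (forall x, G x (M x) <> 0) -> (forall x v, G x v <> 0 -> M x <= v) ->
  recf C M.
Proof.
  intros [c Hc]%(fun H => recf_sub (ext C) (fun _ => 1) _ (recf_const _ 1) H) HM Hmin.
  exists (Mu c); intros x; apply eval_mu with (G x); auto.
  intros m; exact (Hc (x, m)).
Qed.

Section CodeInd.
  Variable P : code -> Prop.
  Hypothesis HZ : P Zero.
  Hypothesis HS : P Succ.
  Hypothesis HP : forall i, P (Proj i).
  Hypothesis HO : P Oracle.
  Hypothesis HC : forall f gs, P f -> Forall P gs -> P (Comp f gs).
  Hypothesis HR : forall f g, P f -> P g -> P (Prim f g).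
  Hypothesis HM : forall f, P f -> P (Mu f).

  (** The inner fixpoint supplies induction hypotheses for the programs in the list of [Comp], which
      the generated principle lacks. *)
  Fixpoint code_nested_ind (c : code) : P c :=
    match c with
    | Zero => HZ
    | Succ => HS
    | Proj i => HP i
    | Oracle => HO
    | Comp f gs =>
        HC f gs (code_nested_ind f)
          ((fix go l : Forall P l :=
              match l with
              | nil => Forall_nil P
              | g :: l' => Forall_cons g (code_nested_ind g) (go l')
              end) gs)
    | Prim f g => HR f g (code_nested_ind f) (code_nested_ind g)
    | Mu f => HM f (code_nested_ind f)
    end.
End CodeInd.

(** * Stages of c.e. sets *)

(** Evaluation with all searches bounded by [s] and the zero oracle; a value
    [v] is reported as [S v], failure as [0]. *)
Fixpoint clk (c : code) (s : nat) (args : list nat) : nat :=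
  match c with
  | Zero => 1
  | Succ => match args with nil => 0 | x :: _ => S (S x) end
  | Proj i => if i <? length args then S (nth i args 0) else 0
  | Oracle => match args with nil => 0 | _ => 1 end
  | Comp f gs =>
      let ys := map (fun g => clk g s args) gs in
      fold_right (fun y r => (1 - (1 - y)) * r) 1 ys * clk f s (map pred ys)
  | Prim f g =>
      match args with
      | nil => 0
      | n :: a =>
          nat_rect (fun _ => nat) (clk f s a)
            (fun m r => (1 - (1 - r)) * clk g s (m :: pred r :: a)) n
      end
  | Mu f =>
      (* [0]: still searching; [1]: some value diverged; [m + 2]: found [m] *)
      pred (nat_rect (fun _ => nat) 0
        (fun m r => r + (1 - r) *
           ((1 - clk f s (m :: args)) + eqt (clk f s (m :: args)) 1 * (m + 2))) s)
  end.

(** The program [c] is fixed, so no universal program is required. Context and argument list are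
    general because [Prim] and [Mu] call subprograms with additional variables. *)
Lemma recf_clk c : forall (C : ctx) S (As : list (C -> nat)),
  recf C S -> Forall (recf C) As ->
  recf C (fun x => clk c (S x) (map (fun A => A x) As)).
Proof.
  induction c as [| |i| |f gs IHf IHgs|f g IHf IHg|f IHf] using code_nested_ind;
    intros C S As HS HAs; simpl.
  - apply recf_const.
  - destruct HAs; simpl; auto with recdb.
  - destruct (Nat.ltb_spec i (length As)) as [Hi|Hi].
    + apply (recf_ext (fun x => Datatypes.S (nth i As (fun _ => 0) x))).
      * apply recf_S; rewrite Forall_forall in HAs; apply HAs, nth_In, Hi.
      * intros x; rewrite length_map; apply Nat.ltb_lt in Hi; rewrite Hi; f_equal.
        apply (map_nth (fun A : C -> nat => A x) As (fun _ => 0) i).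
    + apply (recf_ext (fun _ => 0)); [apply recf_const|].
      intros x; rewrite length_map; apply Nat.ltb_ge in Hi; now rewrite Hi.
  - destruct HAs; simpl; auto with recdb.
  - apply recf_mul.
    + induction IHgs as [|g gs Hg _ IH]; simpl; auto 6 with recdb.
    + apply (recf_ext (fun x => clk f (S x)
        (map (fun A : C -> nat => A x)
           (map (fun g x => pred (clk g (S x) (map (fun A => A x) As))) gs)))).
      * apply IHf; [exact HS|].
        induction IHgs as [|g gs Hg _ IH]; simpl; constructor; auto with recdb.
      * intros x; f_equal; now rewrite !map_map.
  - destruct HAs as [|N As HN HAs]; simpl; [apply recf_const|].
    apply (recf_nat C N _ (fun x m r => (1 - (1 - r)) *
       clk g (S x) (m :: pred r :: map (fun A => A x) As))); auto.
    apply recf_mul; [auto with recdb|].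
    apply (recf_ext (fun y : ext (ext C) => clk g (S (fst (fst y)))
      (map (fun A : ext (ext C) -> nat => A y)
         ((fun y => snd y) :: (fun y => pred (snd (fst y)))
           :: map (fun A y => A (fst (fst y))) As)))).
    + apply (IHg (ext (ext C))); [auto with recdb|].
      constructor; [auto with recdb|]; constructor; [auto with recdb|].
      induction HAs; simpl; constructor; auto with recdb.
    + intros y; simpl; now rewrite map_map.
  - apply recf_pred.
    assert (Hf : recf (ext (ext C)) (fun y => clk f (S (fst (fst y)))
                   (snd y :: map (fun A => A (fst (fst y))) As))).
    { apply (recf_ext (fun y : ext (ext C) => clk f (S (fst (fst y)))
        (map (fun A : ext (ext C) -> nat => A y)
           ((fun y => snd y) :: map (fun A y => A (fst (fst y))) As)))).
      - apply (IHf (ext (ext C))); [auto with recdb|].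
        constructor; [auto with recdb|].
        induction HAs; simpl; constructor; auto with recdb.
      - intros y; simpl; now rewrite map_map. }
    apply (recf_nat C S _ (fun x m r => r + (1 - r) *
       ((1 - clk f (S x) (m :: map (fun A => A x) As))
        + eqt (clk f (S x) (m :: map (fun A => A x) As)) 1 * (m + 2)))); auto 10 with recdb.
Qed.

(** Asking for the value at all large bounds lets finitely many subcomputations be merged by
    [max]. *)
Lemma clk_complete c : forall args v, eval (fun _ => 0) c args v ->
  exists s0, forall s, s0 <= s -> clk c s args = S v.
Proof.
  induction c as [| |i| |f gs IHf IHgs|f g IHf IHg|f IHf] using code_nested_ind;
    intros args v H; simpl.
  - inversion H; subst; now exists 0.
  - inversion H; subst; now exists 0.
  - inversion H; subst; exists 0; intros s _.
    match goal with Hi : i < _ |- _ => apply Nat.ltb_lt in Hi; now rewrite Hi end.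
  - inversion H; subst; now exists 0.
  - inversion H as [| | | |? ? ? ys ? Hgs Hf| | |]; subst.
    assert (Hm : exists s0, forall s, s0 <= s ->
      map (fun g => clk g s args) gs = map S ys).
    { clear H Hf; revert ys Hgs; induction IHgs as [|g gs Hg _ IH]; intros ys Hgs.
      - inversion Hgs; subst; now exists 0.
      - inversion Hgs as [|? ? ? y ys' Hy Hys]; subst.
        destruct (Hg _ _ Hy) as [s1 H1], (IH _ Hys) as [s2 H2].
        exists (max s1 s2); intros s Hs; simpl; rewrite H1, H2 by lia; easy. }
    destruct Hm as [s1 H1], (IHf _ _ Hf) as [s2 H2].
    exists (max s1 s2); intros s Hs; rewrite H1 by lia.
    rewrite map_map; simpl; rewrite map_id, H2 by lia.
    enough (E : fold_right (fun y r => (1 - (1 - y)) * r) 1 (map S ys) = 1) by lia.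
    clear; induction ys as [|y ys IH]; simpl in *; lia.
  - destruct args as [|n a]; [inversion H|].
    revert v H; induction n as [|n IH]; intros v H; inversion H; subst; simpl.
    + apply IHf; easy.
    + match goal with Hr : eval _ (Prim f g) _ _ |- _ => destruct (IH _ Hr) as [s1 H1] end.
      match goal with Hr : eval _ g _ _ |- _ => destruct (IHg _ _ Hr) as [s2 H2] end.
      exists (max s1 s2); intros s Hs.
      rewrite H1 by lia; simpl; rewrite H2 by lia; lia.
  - inversion H as [| | | | | | |? ? n H0 Hlt]; subst.
    destruct (IHf _ _ H0) as [s1 H1].
    assert (Hm : exists s0, forall s, s0 <= s -> forall m, m < v -> 2 <= clk f s (m :: args)).
    { clear H H0 H1; induction v as [|v IH]; [exists 0; lia|].
      destruct IH as [s2 H2]; [intros m Hm; apply Hlt; lia|].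
      destruct (Hlt v) as [u [Hu Eu]]; [lia|].
      destruct (IHf _ _ Eu) as [s3 H3].
      exists (max s2 s3); intros s Hs m Hm.
      destruct (Nat.eq_dec m v) as [->|Hn]; [rewrite H3 by lia; lia|apply H2; lia]. }
    destruct Hm as [s2 H2].
    (* The search makes [s] rounds, and candidate [v] is examined in round [S v]. *)
    exists (S v + max s1 s2); intros s Hs.
    specialize (H1 s ltac:(lia)); specialize (H2 s ltac:(lia)).
    set (stp := fun m r => _).
    enough (E : forall k, nat_rect (fun _ => nat) 0 stp k
                  = if k <=? v then 0 else v + 2).
    { rewrite E; destruct (Nat.leb_spec s v); lia. }
    induction k as [|k IH]; [easy|]; simpl nat_rect; rewrite IH; unfold stp.
    destruct (Nat.leb_spec k v), (Nat.leb_spec (S k) v); try lia.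
    + specialize (H2 k ltac:(lia)); unfold eqt; nia.
    + replace k with v by lia; rewrite H1; unfold eqt; simpl; lia.
Qed.

Lemma clk_sound c : forall s args v, clk c s args = S v -> eval (fun _ => 0) c args v.
Proof.
  induction c as [| |i| |f gs IHf IHgs|f g IHf IHg|f IHf] using code_nested_ind;
    intros s args v H; simpl in H.
  - injection H as <-; apply e_zero.
  - destruct args; [easy|]; injection H as <-; apply e_succ.
  - destruct (Nat.ltb_spec i (length args)); [|easy].
    injection H as <-; now apply e_proj.
  - destruct args; [easy|]; injection H as <-; apply (e_orac (fun _ => 0)).
  - apply e_comp with (map (fun g => pred (clk g s args)) gs).
    + assert (Hf : fold_right (fun y r => (1 - (1 - y)) * r) 1
          (map (fun g => clk g s args) gs) <> 0) by (intros E; rewrite E in H; easy).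
      clear H; induction IHgs as [|g gs Hg _ IH]; simpl in *; constructor.
      * apply Hg with s; lia.
      * apply IH; lia.
    + apply IHf with s; rewrite map_map in H.
      assert (Hf : fold_right (fun y r => (1 - (1 - y)) * r) 1
          (map (fun g => clk g s args) gs) <= 1).
      { clear; induction gs; simpl in *; nia. }
      destruct (fold_right _ _ _) as [|[|k]]; lia.
  - destruct args as [|n a]; [easy|].
    revert v H; induction n as [|n IH]; intros v H; simpl in H.
    + apply e_prim0, IHf with s, H.
    + destruct (nat_rect _ _ _ n) as [|r] eqn:E; [easy|].
      apply e_primS with r; [now apply IH|].
      apply IHg with s; simpl in H; lia.
  - set (stp := fun m r => _) in H.
    (* Invariant after [k] rounds: in state [0] all candidates so far had positive values, and in
       state [u + 2] the least zero is [u]. State [1] is absorbing. *)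
    assert (E : forall k, 
      let r := nat_rect (fun _ => nat) 0 stp k in
      (r = 0 -> forall m, m < k -> 2 <= clk f s (m :: args)) /\
      (forall u, r = S (S u) -> clk f s (u :: args) = 1 /\
         forall m, m < u -> 2 <= clk f s (m :: args))).
    { induction k as [|k IH]; [split; [lia|easy]|]; simpl in IH; simpl.
      destruct (nat_rect _ _ _ k) as [|[|u']]; destruct IH as [IH1 IH2]; unfold stp.
      - specialize (IH1 eq_refl).
        assert (D : clk f s (k :: args) = 0 \/ clk f s (k :: args) = 1 \/
                    2 <= clk f s (k :: args)) by lia.
        unfold eqt; destruct D as [D|[D|D]].
        + rewrite D; split; [easy|]; intros u Hu; lia.
        + rewrite D; split; [lia|]; intros u Hu.
          replace u with k by lia; auto.
        + split; [|intros u Hu; exfalso].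
          * intros _ m Hm; destruct (Nat.eq_dec m k) as [->|Hn]; [easy|apply IH1; lia].
          * nia.
      - split; [easy|]; intros u Hu; lia.
      - split; [easy|]; intros u Hu; apply IH2; lia. }
    destruct (proj2 (E s) v) as [H1 H2]; [lia|].
    apply e_mu; [apply IHf with s, H1|].
    intros m Hm; specialize (H2 m Hm).
    exists (pred (clk f s (m :: args))); split; [lia|].
    apply IHf with s; lia.
Qed.

(** Quantifying over contexts allows use under any oracle and next to further variables. *)
Definition comp2 (R : nat -> nat -> nat) : Prop :=
  forall (C : ctx) F G, recf C F -> recf C G -> recf C (fun x => R (F x) (G x)).

(** The bound of [clk] serves as the stage of the enumeration. Membership is visible at all large
    stages, which stands in for monotonicity. *)
Lemma ce_stages S : ce S -> exists R, comp2 R /\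
  (forall n s, R n s <> 0 -> S n) /\
  (forall n, S n -> exists s0, forall s, s0 <= s -> R n s <> 0).
Proof.
  intros [c Hc]; exists (fun n s => clk c s [n]); split; [|split].
  - intros C F G HF HG.
    apply (recf_clk c C G [F] HG); auto.
  - intros n s H; apply Hc; exists (pred (clk c s [n])).
    apply clk_sound with s; lia.
  - intros n [v Hv]%Hc; apply clk_complete in Hv; destruct Hv as [s0 H0].
    exists s0; intros s Hs; now rewrite H0.
Qed.

Definition nat_ctx : ctx :=
  {| pt := nat; orc := fun _ _ => 0; vars := fun n => [n]; arity := 1;
     length_vars := fun _ => eq_refl |}.

(** The converse of [ce_stages]: an unbounded search for [w] halts exactly on the members. *)
Lemma ce_exists T : comp2 T -> ce (fun n => exists w, T n w <> 0).
Proof.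
  intros HT.
  assert (H : recf (ext nat_ctx) (fun y => 1 - T (fst y) (snd y))).
  { apply recf_sub; [apply recf_const|]; apply HT; [|apply recf_var0].
    apply (recf_weak1 nat_ctx (fun n => n)), (recf_nth nat_ctx 0); simpl; lia. }
  destruct H as [c Hc]; exists (Mu c); intros n; split.
  - intros Hex.
    destruct (least_nonzero (T n) Hex) as [w [Hw Hmin]]; exists w.
    apply eval_mu with (T n); auto.
    intros m; exact (Hc (n, m)).
  - intros [v Hv]; exists v.
    inversion Hv as [| | | | | | |? ? ? H0 _]; subst.
    (* Determinism through [clk]: at a common stage the program shows both the value [0], since [Mu]
       halted at [v], and the value [1 - T n v]. *)
    apply clk_complete in H0; destruct H0 as [s1 H1].
    pose proof (Hc (n, v)) as H2; apply clk_complete in H2; destruct H2 as [s2 H2].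
    specialize (H1 (max s1 s2) ltac:(lia)); specialize (H2 (max s1 s2) ltac:(lia)).
    simpl in H2; rewrite H1 in H2; injection H2; lia.
Qed.

Lemma ce_ext (S S' : nat -> Prop) : (forall n, S n <-> S' n) -> ce S -> ce S'.
Proof. intros H [c Hc]; exists c; intros n; now rewrite <- H. Qed.

(** * Strings and cylinders *)

Definition prefix (X : cantor) (n : nat) : list bool := map X (seq 0 n).

Lemma length_prefix X n : length (prefix X n) = n.
Proof. unfold prefix; now rewrite length_map, length_seq. Qed.

Lemma nth_prefix X n k : k < n -> nth k (prefix X n) false = X k.
Proof.
  intros H; unfold prefix.
  rewrite nth_indep with (d' := X 0) by now rewrite length_map, length_seq.
  now rewrite map_nth, seq_nth.
Qed.

Lemma cyl_prefix X n : cyl (prefix X n) X.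
Proof. intros k Hk; rewrite length_prefix in Hk; now rewrite nth_prefix. Qed.

Lemma cyl_app s t X : cyl (s ++ t) X -> cyl s X.
Proof.
  intros H k Hk; rewrite H; [now rewrite app_nth1|rewrite length_app; lia].
Qed.

(** [code_str] is bijective base two with digits [1] and [2], least significant first, so an
    appended string is shifted by [length s] places. *)
Lemma code_str_app s t :
  code_str (s ++ t) = code_str s + 2 ^ length s * code_str t.
Proof. induction s as [|b s IH]; simpl; [lia|]; rewrite IH; destruct b; lia. Qed.

Lemma code_str_prefix X n :
  code_str (prefix X n) = bsum n (fun k => 2 ^ k * S (b2n (X k))).
Proof.
  induction n as [|n IH]; [easy|].
  unfold prefix in *; rewrite seq_S, map_app, code_str_app, IH, length_map, length_seq.
  simpl; unfold b2n; destruct (X n); fold (bsum n (fun k => 2 ^ k * S (b2n (X k)))); nia.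
Qed.

(** Parity determines the first digit of a code, so the bits of [s] can be read off the code of [t]
    one by one. *)
Lemma code_str_split s t j :
  code_str t = code_str s + 2 ^ length s * j -> exists t', t = s ++ t'.
Proof.
  revert t; induction s as [|b s IH]; intros t H; [now exists t|].
  destruct t as [|c t]; [simpl in H; destruct b; lia|].
  simpl in H; assert (E : b = c) by (destruct b, c; [easy|lia|lia|easy]); subst c.
  destruct (IH t) as [t' ->]; [destruct b; lia|]; now exists t'.
Qed.

Lemma code_str_inj s t : code_str s = code_str t -> s = t.
Proof.
  revert t; induction s as [|b s IH]; intros [|c t] H; simpl in H;
    [easy|destruct c; lia|destruct b; lia|].
  assert (E : b = c) by (destruct b, c; [easy|lia|lia|easy]); subst c.
  f_equal; apply IH; destruct b; lia.
Qed.

Lemma code_str_lt s : code_str s + 1 < 2 ^ S (length s).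
Proof. induction s as [|[] s IH]; simpl in *; lia. Qed.

Lemma code_str_ge s : 2 ^ length s <= code_str s + 1.
Proof. induction s as [|[] s IH]; simpl in *; lia. Qed.

(** The codes of strings of length [n] fill an interval of [2 ^ n] numbers from [2 ^ n - 1] on;
    quantifying over such strings is thus a bounded quantification. *)
Lemma code_str_surj_length n e :
  e < 2 ^ n -> exists s, length s = n /\ code_str s = 2 ^ n - 1 + e.
Proof.
  revert e; induction n as [|n IH]; intros e He.
  - exists nil; simpl in *; lia.
  - pose proof (Nat.div2_odd e) as E; simpl in He.
    destruct (IH (Nat.div2 e)) as [s [Hl Hs]].
    { destruct (Nat.odd e); simpl in E; lia. }
    pose proof (Nat.pow_nonzero 2 n).
    exists (Nat.odd e :: s); simpl; destruct (Nat.odd e); simpl in E; lia.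
Qed.

Lemma code_str_surj e : exists s, code_str s = e.
Proof.
  pose proof (Nat.log2_spec (e + 1) ltac:(lia)) as H; simpl in H.
  destruct (code_str_surj_length (Nat.log2 (e + 1)) (e + 1 - 2 ^ Nat.log2 (e + 1)))
    as [s [_ Hs]]; [lia|].
  exists s; pose proof (Nat.pow_nonzero 2 (Nat.log2 (e + 1))); lia.
Qed.

Lemma cyl_in_cyl_prefix Z i s :
  (forall X, cyl s X -> forall k, k < i -> X k = Z k) -> exists s', s = prefix Z i ++ s'.
Proof.
  intros H.
  assert (Hn : forall k, k < i -> k < length s /\ nth k s false = Z k).
  { intros k Hk.
    (* Beyond its end [s] is continued with the bit that differs from [Z k], so a too short [s] is
       refuted. *)
    assert (E := H (fun k => nth k s (negb (Z k)))); simpl in E.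
    specialize (E (fun k Hk => nth_indep _ _ _ Hk) k Hk).
    assert (L : k < length s).
    { apply Nat.nle_gt; intros L; rewrite nth_overflow in E by easy.
      now destruct (Z k). }
    split; [easy|]; rewrite <- E; now apply nth_indep. }
  exists (skipn i s); rewrite <- (firstn_skipn i s) at 1; f_equal.
  assert (L : i <= length s).
  { destruct i as [|i]; [lia|]; apply (Hn i); lia. }
  apply nth_ext with false false; rewrite length_firstn, Nat.min_l by easy.
  - now rewrite length_prefix.
  - intros k Hk; rewrite nth_prefix by easy.
    rewrite nth_firstn; apply Nat.ltb_lt in Hk as Hk'; rewrite Hk'; now apply Hn.
Qed.

(** * Measure by counting strings *)

Lemma length_all_strings N : length (all_strings N) = 2 ^ N.
Proof.
  induction N as [|N IH]; [easy|]; simpl.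
  rewrite length_app, !length_map, IH; lia.
Qed.

Lemma prefixb_spec s t : prefixb s t = true <-> exists t', t = s ++ t'.
Proof.
  unfold prefixb; destruct (list_eq_dec _ _ _) as [E|E]; split; try easy.
  - intros _; exists (skipn (length s) t); rewrite <- E at 1; now rewrite firstn_skipn.
  - intros [t' ->]; exfalso; apply E; now rewrite firstn_app, firstn_all, Nat.sub_diag, app_nil_r.
Qed.

Lemma prefixb_cons b s c t : prefixb (b :: s) (c :: t) = Bool.eqb b c && prefixb s t.
Proof.
  apply Bool.eq_true_iff_eq; rewrite Bool.andb_true_iff, !prefixb_spec, Bool.eqb_true_iff.
  split.
  - intros [t' E]; injection E as -> ->; split; [easy|now exists t'].
  - intros [-> [t' ->]]; now exists t'.
Qed.

Lemma filter_map_length {A B} (f : A -> B) p l :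
  length (filter p (map f l)) = length (filter (fun x => p (f x)) l).
Proof. induction l as [|x l IH]; simpl; [easy|]; destruct (p (f x)); simpl; congruence. Qed.

Lemma filter_length_mono {A} (p q : A -> bool) l :
  (forall x, p x = true -> q x = true) -> length (filter p l) <= length (filter q l).
Proof.
  intros H; induction l as [|x l IH]; simpl; [lia|].
  destruct (p x) eqn:E; [rewrite (H x E); simpl; lia|].
  destruct (q x); simpl; lia.
Qed.

Lemma filter_none {A} (p : A -> bool) l :
  (forall x, p x = false) -> length (filter p l) = 0.
Proof. intros H; induction l as [|x l IH]; simpl; [easy|]; now rewrite H. Qed.

(** A cylinder has measure at most [2 ^ - length s]: each bit of [s] discards one half of
    [all_strings]. *)
Lemma count_prefixb s N :
  length (filter (prefixb s) (all_strings N)) * 2 ^ length s <= 2 ^ N.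
Proof.
  revert N; induction s as [|b s IH]; intros N.
  - pose proof (filter_length_le (prefixb []) (all_strings N)) as H.
    rewrite length_all_strings in H; simpl; lia.
  - destruct N as [|N]; [simpl; lia|].
    simpl all_strings; rewrite filter_app, length_app, !filter_map_length.
    specialize (IH N); simpl length.
    assert (H : forall c, length (filter (fun t => prefixb (b :: s) (c :: t)) (all_strings N))
      <= if Bool.eqb b c then length (filter (prefixb s) (all_strings N)) else 0).
    { intros c; destruct (Bool.eqb b c) eqn:E.
      - apply filter_length_mono; intros t; rewrite prefixb_cons, E; easy.
      - rewrite filter_none; [easy|]; intros t; now rewrite prefixb_cons, E. }
    pose proof (H true) as H1; pose proof (H false) as H2.
    rewrite (Nat.pow_succ_r' _ N), Nat.pow_succ_r'.
    destruct b; simpl Bool.eqb in *; cbv iota in *; nia.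
Qed.

(** Prepending a bit halves the measure: the count stays the same among twice as many strings. *)
Lemma count_cover_cons b L N : count_cover (map (cons b) L) (S N) = count_cover L N.
Proof.
  assert (H : forall c t, existsb (fun s => prefixb s (c :: t)) (map (cons b) L)
     = Bool.eqb b c && existsb (fun s => prefixb s t) L).
  { intros c t; induction L as [|s L IH]; simpl; [now rewrite Bool.andb_false_r|].
    now rewrite IH, prefixb_cons, Bool.andb_orb_distrib_r. }
  unfold count_cover; simpl all_strings; rewrite filter_app, length_app, !filter_map_length.
  rewrite (filter_ext _ _ (H false)), (filter_ext _ _ (H true)).
  destruct b; simpl; rewrite (filter_none (fun _ => false)); auto.
Qed.

(** * Martin-Loef tests *)

Lemma unif_eff_open_stages V : unif_eff_open V -> exists R, comp2 R /\
  (forall i s w, R (cpair i (code_str s)) w <> 0 -> forall X, cyl s X -> V i X) /\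
  (forall i s, (forall X, cyl s X -> V i X) ->
     exists w0, forall w, w0 <= w -> R (cpair i (code_str s)) w <> 0).
Proof.
  intros [_ [R [HR [H1 H2]]]%ce_stages]; exists R; split; [exact HR|split].
  - intros i s w [i' [s' [E H]]]%H1; apply cpair_inj in E.
    destruct E as [-> E]; apply code_str_inj in E; now subst s'.
  - intros i s H; apply H2; now exists i, s.
Qed.

Lemma isOpen_prefix (V : cantor -> Prop) X :
  isOpen V -> V X -> exists n, forall Y, cyl (prefix X n) Y -> V Y.
Proof.
  intros HV [n Hn]%HV; exists n; intros Y HY; apply Hn; intros k Hk.
  rewrite HY by (now rewrite length_prefix); now apply nth_prefix.
Qed.

(** Openness makes membership depend on values only, which takes care of pointwise equal
    sequences. *)
Lemma isOpen_ext (V : cantor -> Prop) X Y :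
  isOpen V -> (forall n, X n = Y n) -> V X -> V Y.
Proof. intros HV E [n Hn]%HV; now apply Hn. Qed.

Definition scons (b : bool) (X : cantor) : cantor :=
  fun n => match n with 0 => b | S k => X k end.

Lemma cyl_scons b s X : cyl (b :: s) (scons b X) <-> cyl s X.
Proof.
  split; intros H k Hk; [apply (H (S k)); simpl; lia|].
  destruct k as [|k]; [easy|]; apply H; simpl in Hk; lia.
Qed.

Lemma cyl_cons_sub b s (V : cantor -> Prop) : isOpen V ->
  (forall X, cyl (b :: s) X -> V X) <-> (forall X, cyl s X -> V (scons b X)).
Proof.
  intros HV; split; intros H X HX; [now apply H, cyl_scons|].
  apply isOpen_ext with (scons b (fun n => X (S n))); [easy| |].
  - intros [|n]; [symmetry; apply (HX 0); simpl; lia|easy].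
  - apply H; intros k Hk; apply (HX (S k)); simpl; lia.
Qed.

(** Removing a first bit at most doubles the measure; the index [S i] compensates for the factor. *)
Lemma ML_test_shift V b : ML_test V -> ML_test (fun i X => V (S i) (scons b X)).
Proof.
  intros [HV HM]; split; [split|].
  - intros i X H; apply HV in H; destruct H as [n Hn]; exists n; intros Y HY.
    apply Hn; intros [|k] Hk; [easy|]; apply HY; lia.
  - destruct (unif_eff_open_stages V HV) as [R [HR [H1 H2]]]; unfold comp2 in HR.
    (* Both components of the pair coded by [n] are at most [n]. If [j] codes [s], then
       [2 * j + if b then 2 else 1] codes [b :: s]. *)
    set (T := fun n w => bsum (S n) (fun i => bsum (S n) (fun j =>
      eqt (cpair i j) n * R (cpair (S i) (2 * j + if b then 2 else 1)) w))).
    apply ce_ext with (fun n => exists w, T n w <> 0).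
    + intros n; split.
      * intros [w Hw]; unfold T in Hw.
        apply bsum_neq0 in Hw; destruct Hw as [i [_ Hw]].
        apply bsum_neq0 in Hw; destruct Hw as [j [_ Hw]].
        apply Nat.neq_mul_0 in Hw; destruct Hw as [E%eqt_neq0 Hw].
        destruct (code_str_surj j) as [s <-].
        exists i, s; split; [easy|].
        apply cyl_cons_sub; [apply HV|].
        now apply (H1 (S i) (b :: s) w).
      * intros [i [s [-> H]]]; rewrite <- cyl_cons_sub in H by apply HV.
        apply H2 in H; destruct H as [w Hw]; exists w; unfold T.
        pose proof (cpair_ge i (code_str s)).
        apply bsum_neq0; exists i; split; [lia|].
        apply bsum_neq0; exists (code_str s); split; [lia|].
        apply Nat.neq_mul_0; split; [now apply eqt_neq0|now apply Hw].
    + apply ce_exists; intros C F G HF HG; unfold T.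
      auto 20 with recdb.
  - intros i L N H; specialize (HM (S i) (map (cons b) L) (S N)).
    rewrite count_cover_cons in HM.
    rewrite !Nat.pow_succ_r' in HM.
    enough (count_cover L N * (2 * 2 ^ i) <= 2 * 2 ^ N) by nia.
    apply HM; intros s' Hs'; apply in_map_iff in Hs'; destruct Hs' as [s [<- Hs]].
    destruct (H s Hs) as [H1 H2]; split; [|simpl; lia].
    apply cyl_cons_sub; [apply HV|exact H1].
Qed.

(** Induction on the number [S] of prepended bits: a test capturing [Y], shifted by the first bit of
    [Y], captures the tail of [Y]. *)
Lemma MLR_prepend S X Y : MLR X -> (forall k, Y (S + k) = X k) -> MLR Y.
Proof.
  revert Y; induction S as [|S IH]; intros Y HX E V HV HY.
  - apply (HX V HV); intros i; apply isOpen_ext with Y; [apply HV| |easy].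
    intros n; now rewrite <- E.
  - assert (H : MLR (fun n => Y (Datatypes.S n))) by (apply IH; [exact HX|intros k; apply E]).
    apply (H _ (ML_test_shift V (Y 0) HV)); intros i.
    apply isOpen_ext with Y; [apply HV| |easy]; now intros [|n].
Qed.

(** The cylinders of the initial segments of [Z] form a test. *)
Lemma computable_not_random (Z : cantor) :
  (forall (C : ctx) F, recf C F -> recf C (fun x => b2n (Z (F x)))) ->
  exists V, ML_test V /\ forall i, V i Z.
Proof.
  intros HZ; exists (fun i X => forall k, k < i -> X k = Z k).
  split; [split; [split|]|easy].
  - intros i X H; exists i; intros Y HY k Hk; now rewrite HY, H.
  - set (T := fun n w => bsum (S n) (fun i => bsum (S n) (fun j =>
      eqt (cpair i j) n *
      eqt j (bsum i (fun k => 2 ^ k * S (b2n (Z k))) + 2 ^ i * w)))).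
    apply ce_ext with (fun n => exists w, T n w <> 0).
    + intros n; split.
      * intros [w Hw]; unfold T in Hw.
        apply bsum_neq0 in Hw; destruct Hw as [i [_ Hw]].
        apply bsum_neq0 in Hw; destruct Hw as [j [_ Hw]].
        apply Nat.neq_mul_0 in Hw; destruct Hw as [E%eqt_neq0 Hw%eqt_neq0].
        destruct (code_str_surj j) as [s Hs].
        rewrite <- code_str_prefix, <- Hs in Hw.
        rewrite <- (length_prefix Z i) in Hw at 2.
        destruct (code_str_split _ _ _ Hw) as [s' ->].
        exists i, (prefix Z i ++ s'); split; [now rewrite Hs|].
        intros X HX%cyl_app k Hk.
        rewrite HX by (now rewrite length_prefix); now apply nth_prefix.
      * intros [i [s [-> H]]]; destruct (cyl_in_cyl_prefix Z i s H) as [s' ->].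
        exists (code_str s'); unfold T.
        pose proof (cpair_ge i (code_str (prefix Z i ++ s'))).
        apply bsum_neq0; exists i; split; [lia|].
        apply bsum_neq0; exists (code_str (prefix Z i ++ s')); split; [lia|].
        apply Nat.neq_mul_0; split; apply eqt_neq0; [easy|].
        now rewrite code_str_app, length_prefix, code_str_prefix.
    + apply ce_exists; intros C F G HF HG; unfold T.
      auto 20 with recdb.
  - intros i L N H.
    eapply Nat.le_trans; [|apply (count_prefixb (prefix Z i) N)].
    rewrite length_prefix; apply Nat.mul_le_mono_r, filter_length_mono.
    intros t Ht; apply existsb_exists in Ht; destruct Ht as [s [Hs Hp]].
    destruct (cyl_in_cyl_prefix Z i s (proj1 (H s Hs))) as [s' ->].
    apply prefixb_spec in Hp; destruct Hp as [t' ->].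
    apply prefixb_spec; exists (s' ++ t'); now rewrite app_assoc.
Qed.

Lemma recf_nth_list (l : list bool) (C : ctx) F :
  recf C F -> recf C (fun x => b2n (nth (F x) l false)).
Proof.
  revert C F; induction l as [|b l IH]; intros C F HF.
  - apply (recf_ext (fun _ => 0)); [apply recf_const|]; intros x; now destruct (F x).
  - apply (recf_ext (fun x => nat_rect (fun _ => nat) (b2n b)
      (fun n _ => b2n (nth n l false)) (F x))).
    + apply recf_nat; [easy|apply recf_const|apply IH, recf_var0].
    + intros x; now destruct (F x).
Qed.

Lemma universal_zeros U s i : universal_ML_test U -> U i (fun k => nth k s false).
Proof.
  intros [_ HU].
  destruct (computable_not_random (fun k => nth k s false)) as [V [HV HZ]].
  - intros C F; apply recf_nth_list.
  - now apply (HU V HV).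
Qed.

Lemma eventually_forall_lt (P : nat -> nat -> Prop) n :
  (forall i, i < n -> exists w0, forall w, w0 <= w -> P i w) ->
  exists w0, forall w, w0 <= w -> forall i, i < n -> P i w.
Proof.
  induction n as [|n IH]; intros H; [exists 0; lia|].
  destruct IH as [w1 H1]; [intros i Hi; apply H; lia|].
  destruct (H n) as [w2 H2]; [lia|].
  exists (max w1 w2); intros w Hw i Hi.
  destruct (Nat.eq_dec i n) as [->|Hn]; [apply H2; lia|apply H1; lia].
Qed.

Definition comp1 (f : nat -> nat) : Prop :=
  forall (C : ctx) F, recf C F -> recf C (fun x => f (F x)).

(** Each [s] followed by zeros lies in every [U i], hence finitely many zeros suffice by openness.
    Only finitely many pairs of [i] and [s] occur for given [n], so a search finds a common
    bound. *)
Lemma universal_padding U : universal_ML_test U -> exists w, comp1 w /\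
  forall n i s, i <= n -> length s = n ->
    forall X, cyl (s ++ repeat false (w n)) X -> U i X.
Proof.
  intros HU; pose proof (proj1 HU) as [HUo _].
  destruct (unif_eff_open_stages U HUo) as [R [HR [H1 H2]]]; unfold comp2 in HR.
  assert (Hc : forall s k, code_str (s ++ repeat false k)
    = code_str s + 2 ^ length s * (2 ^ k - 1)).
  { intros s k; rewrite code_str_app; do 2 f_equal.
    induction k as [|k IH]; [easy|]; simpl; rewrite IH.
    pose proof (Nat.pow_nonzero 2 k); lia. }
  (* [2 ^ n - 1 + e] runs through the codes of strings of length [n]; appending [k] zeros adds
     [2 ^ n * (2 ^ k - 1)]. The search value [v] bounds [k] and is the stage as well. *)
  set (T := fun n v => bprod (S n) (fun i => bprod (2 ^ n) (fun e => bsum (S v) (fun k =>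
     R (cpair i ((2 ^ n - 1) + e + 2 ^ n * (2 ^ k - 1))) v)))).
  assert (HT : comp2 T).
  { intros C F G HF HG; unfold T; auto 20 with recdb. }
  assert (Hex : forall n, exists v, T n v <> 0).
  { intros n; unfold T.
    destruct (eventually_forall_lt (fun i v => forall e, e < 2 ^ n ->
      bsum (S v) (fun k => R (cpair i ((2 ^ n - 1) + e + 2 ^ n * (2 ^ k - 1))) v) <> 0) (S n))
      as [v Hv].
    - intros i _; apply eventually_forall_lt; intros e He.
      destruct (code_str_surj_length n e He) as [s [Hl Hs]].
      destruct (isOpen_prefix (U i) (fun k => nth k s false)) as [m Hm];
        [apply HUo|now apply universal_zeros|].
      destruct (H2 i (s ++ repeat false m)) as [w0 Hw].
      + intros X HX; apply Hm; intros k Hk; rewrite length_prefix in Hk.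
        rewrite nth_prefix by easy; rewrite HX.
        * destruct (Nat.lt_ge_cases k (length s)) as [L|L].
          -- now rewrite app_nth1.
          -- rewrite app_nth2, nth_repeat, nth_overflow; easy.
        * rewrite length_app, repeat_length; lia.
      + exists (max w0 m); intros v Hv; apply bsum_neq0; exists m; split; [lia|].
        rewrite <- Hs, <- Hl, <- Hc; apply Hw; lia.
    - exists v; apply bprod_neq0; intros i Hi; apply bprod_neq0; intros e He.
      now apply Hv. }
  exists (fun n => proj1_sig (least_nonzero (T n) (Hex n))); split.
  - intros C F HF; apply (recf_mu C (fun x => T (F x))).
    + apply HT; auto with recdb.
    + intros x; now destruct (least_nonzero _ _).
    + intros x; now destruct (least_nonzero _ _).
  - intros n i s Hi Hl X; destruct (least_nonzero _ _) as [v [Hv Hmin]]; simpl; intros HX.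
    unfold T in Hv; rewrite bprod_neq0 in Hv; specialize (Hv i ltac:(lia)).
    pose proof (code_str_lt s) as Hlt; pose proof (code_str_ge s) as Hge; rewrite Hl in *.
    rewrite bprod_neq0 in Hv; specialize (Hv (code_str s + 1 - 2 ^ n) ltac:(simpl in *; lia)).
    apply bsum_neq0 in Hv; destruct Hv as [k [Hk Hv]].
    replace (2 ^ n - 1 + (code_str s + 1 - 2 ^ n)) with (code_str s) in Hv
      by (pose proof (Nat.pow_nonzero 2 n); lia).
    rewrite <- Hl, <- Hc in Hv; apply (H1 _ _ _ Hv).
    (* The zeros in excess of [k] only shrink the cylinder. *)
    replace v with (k + (v - k)) in HX by lia.
    rewrite repeat_app, app_assoc in HX; now apply cyl_app in HX.
Qed.

Lemma orecf_weak2 (C : ctx) P :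
  orecf C P -> orecf (ext (ext C)) (fun y => P (fst (fst y))).
Proof. intros H; exact (orecf_weak _ _ (orecf_weak _ _ H)). Qed.
#[local] Hint Resolve orecf_weak2 recf_app : recdb.

Definition comp_functional (f : (nat -> nat) -> nat -> nat -> nat) : Prop :=
  forall (C : ctx) P F G, orecf C P -> recf C F -> recf C G ->
    recf C (fun x => f (P x) (F x) (G x)).

(** At stage [n] one tests whether the cylinder of some initial segment of length at most [n] is
    seen inside [V i]. *)
Lemma unif_eff_open_seen V : unif_eff_open V -> exists seen, comp_functional seen /\
  forall p X, (forall n, p n = b2n (X n)) -> forall i,
    (forall n, seen p i n <> 0 -> V i X) /\
    (V i X -> exists n0, forall n, n0 <= n -> seen p i n <> 0).
Proof.
  intros HV; destruct (unif_eff_open_stages V HV) as [R [HR [H1 H2]]]; unfold comp2 in HR.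
  exists (fun p i n => bsum (S n) (fun k =>
    R (cpair i (bsum k (fun l => 2 ^ l * S (p l)))) n)); split.
  - intros C P F G HP HF HG.
    apply recf_bsum; [auto with recdb|]; unfold orecf.
    apply HR; [|auto with recdb]; apply recf_cpair; [auto with recdb|].
    apply recf_bsum; [auto with recdb|]; unfold orecf.
    apply recf_mul; [auto with recdb|]; apply recf_S.
    exact (orecf_weak _ _ HP).
  - intros p X Hp i.
    assert (E : forall k, bsum k (fun l => 2 ^ l * S (p l)) = code_str (prefix X k)).
    { intros k; rewrite code_str_prefix; apply bsum_ext; intros l; now rewrite Hp. }
    split.
    + intros n H; apply bsum_neq0 in H; destruct H as [k [_ H]].
      rewrite E in H; apply (H1 _ _ _ H), cyl_prefix.
    + intros H; destruct (isOpen_prefix _ _ (proj1 HV i) H) as [m Hm].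
      apply H2 in Hm; destruct Hm as [w0 Hw]; exists (max w0 m); intros n Hn.
      apply bsum_neq0; exists m; split; [lia|]; rewrite E; apply Hw; lia.
Qed.

(** * The reduction *)

Definition phase (seen : nat -> nat -> nat) (n : nat) : nat :=
  nat_rect (fun _ => nat) 0 (fun m a => a + (1 - (1 - seen a m))) n.

(** The position where the current copy of the input begins. The increment [S m + w m] carries it
    beyond [m + w m] from any earlier value. *)
Definition start (seen : nat -> nat -> nat) (w : nat -> nat) (n : nat) : nat :=
  nat_rect (fun _ => nat) 0
    (fun m s => s + (1 - (1 - seen (phase seen m) m)) * (S m + w m)) n.

(** Bit [n] uses the start after stage [n], so a change at stage [n] already affects it. The first
    factor writes zeros before the start. *)
Definition padded (seen : nat -> nat -> nat) (w p : nat -> nat) (n : nat) : nat :=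
  (1 - (start seen w (S n) - n)) * p (n - start seen w (S n)).

Section Phases.
  Variables (seen : nat -> nat -> nat) (w : nat -> nat).
  Let a := phase seen.
  Let st := start seen w.

  Lemma phase_step n :
    (seen (a n) n = 0 /\ a (S n) = a n /\ st (S n) = st n) \/
    (seen (a n) n <> 0 /\ a (S n) = S (a n) /\ st (S n) = st n + (S n + w n)).
  Proof.
    unfold a, st; simpl; fold (phase seen n); fold (start seen w n).
    destruct (Nat.eq_dec (seen (phase seen n) n) 0) as [E|E]; [left|right].
    - rewrite E; simpl; lia.
    - replace (1 - (1 - seen (phase seen n) n)) with 1 by lia; lia.
  Qed.

  Lemma phase_mono m n : m <= n -> a m <= a n.
  Proof. induction 1; [lia|]; destruct (phase_step m0); lia. Qed.

  Lemma start_mono m n : m <= n -> st m <= st n.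
  Proof. induction 1; [lia|]; destruct (phase_step m0); lia. Qed.

  Lemma phase_passed (P : nat -> Prop) :
    (forall b n, seen b n <> 0 -> P b) -> forall n b, b < a n -> P b.
  Proof.
    intros H; induction n as [|n IH]; intros b Hb; [now simpl in Hb|].
    destruct (phase_step n) as [[_ [E _]]|[Hs [E _]]]; rewrite E in Hb; [now apply IH|].
    destruct (Nat.eq_dec b (a n)) as [->|]; [now apply H with n|apply IH; lia].
  Qed.

  Lemma phase_stabilizes B : (forall n, a n <= B) -> exists N, forall n, N <= n -> a n = a N.
  Proof.
    induction B as [|B IH]; intros H.
    - exists 0; intros n _; pose proof (H n); pose proof (H 0); lia.
    - destruct (classic (exists n, a n = S B)) as [[N HN]|Hn].
      + exists N; intros n Hle; pose proof (H n); pose proof (phase_mono N n Hle); lia.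
      + apply IH; intros n; pose proof (H n).
        enough (a n <> S B) by lia; intros E; apply Hn; now exists n.
  Qed.

  (** Position [st N + k] may come before stage [N], but the start is final by then: a later change
      at stage [n] would give a start above [n], hence above [st N]. *)
  Lemma start_final N : (forall n, N <= n -> a n = a N) ->
    forall k, st (S (st N + k)) = st N.
  Proof.
    intros HN.
    assert (Hup : forall n, N <= n -> st n = st N).
    { intros n Hn; induction Hn as [|n Hn IH]; [easy|].
      pose proof (HN n Hn); pose proof (HN (S n) ltac:(lia)).
      destruct (phase_step n); lia. }
    (* a change of [st] after stage [m] would push it beyond [m] *)
    assert (Hlow : forall m n, st N <= m -> m < n -> st n = st (S m)).
    { intros m n Hm Hn; induction Hn as [|n Hn IH]; [easy|].
      assert (st (S n) <= st N).
      { rewrite <- (Hup (max N (S n))) by lia; apply start_mono; lia. }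
      destruct (phase_step n) as [|[_ [_ E]]]; [lia|]; lia. }
    intros k; rewrite <- (Hlow (st N + k) (S (max N (st N + k)))) by lia.
    apply Hup; lia.
  Qed.

  (** The change puts the start beyond [n + w n], and it never moves back. *)
  Lemma padded_zero p n k :
    a (S n) <> a n -> n <= k -> k <= n + w n -> padded seen w p k = 0.
  Proof.
    intros H Hk Hw; unfold padded.
    assert (k < st (S k)).
    { pose proof (start_mono (S n) (S k) ltac:(lia)); destruct (phase_step n); lia. }
    fold st; replace (1 - (st (S k) - k)) with 0 by lia; lia.
  Qed.

  Lemma padded_tail p N : (forall n, N <= n -> a n = a N) ->
    forall k, padded seen w p (st N + k) = p k.
  Proof.
    intros HN k; unfold padded; fold st; rewrite start_final by easy.
    replace (1 - (st N - (st N + k))) with 1 by lia.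
    replace (st N + k - st N) with k by lia; lia.
  Qed.

  Lemma padded_bit p X : (forall n, p n = b2n (X n)) ->
    exists X', forall n, padded seen w p n = b2n (X' n).
  Proof.
    intros Hp; exists (fun n => negb (padded seen w p n =? 0)); intros n.
    unfold padded; rewrite Hp.
    destruct (Nat.eq_dec (start seen w (S n) - n) 0) as [E|E].
    - rewrite E; now destruct (X _).
    - now replace (1 - (start seen w (S n) - n)) with 0 by lia.
  Qed.
End Phases.

(** * Computability of the phases and of the query *)

Lemma recf_phase seen (C : ctx) P N :
  comp_functional seen -> orecf C P -> recf C N ->
  recf C (fun x => phase (seen (P x)) (N x)).
Proof.
  intros Hs HP HN.
  apply (recf_nat C N _ (fun x m a => a + (1 - (1 - seen (P x) a m)))); auto with recdb.
  apply recf_add; [auto with recdb|].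
  do 2 (apply recf_sub; [apply recf_const|]).
  apply (Hs (ext (ext C))); auto with recdb.
Qed.

Lemma orecf_padded seen w (C : ctx) P :
  comp_functional seen -> comp1 w -> orecf C P ->
  orecf C (fun x => padded (seen (P x)) w (P x)).
Proof.
  intros Hs Hw HP.
  assert (H : recf (ext C) (fun y => start (seen (P (fst y))) w (S (snd y)))).
  { apply (recf_nat (ext C) (fun y => S (snd y)) _ (fun y m s => s +
      (1 - (1 - seen (P (fst y)) (phase (seen (P (fst y))) m) m)) * (S m + w m)));
      auto with recdb.
    assert (HP3 := orecf_weak2 _ _ (orecf_weak _ _ HP)).
    apply recf_add; [auto with recdb|]; apply recf_mul;
      [|apply recf_add; [|apply Hw]; auto with recdb].
    do 2 (apply recf_sub; [apply recf_const|]).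
    apply (Hs (ext (ext (ext C)))); auto with recdb.
    apply recf_phase; auto with recdb. }
  unfold orecf, padded.
  apply recf_mul; [auto with recdb|].
  apply (recf_app (ext C) (fun y => P (fst y))); auto with recdb.
Qed.

(** Parity flips at each successor, and [Nat.div2 n] counts the odd numbers below [n]. *)
Lemma recf_div2_odd (C : ctx) F : recf C F ->
  recf C (fun x => Nat.b2n (Nat.odd (F x))) /\ recf C (fun x => Nat.div2 (F x)).
Proof.
  assert (H1 : forall C F, recf C F -> recf C (fun x => Nat.b2n (Nat.odd (F x)))).
  { clear; intros C F HF.
    apply (recf_ext (fun x => nat_rect (fun _ => nat) 0 (fun _ r => 1 - r) (F x))).
    - apply recf_nat; auto with recdb.
    - intros x; induction (F x) as [|n IH]; [easy|]; simpl nat_rect; rewrite <- IH.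
      rewrite Nat.odd_succ, <- Nat.negb_odd; now destruct (Nat.odd n). }
  intros HF; split; [now apply H1|].
  apply (recf_ext (fun x => bsum (F x) (fun k => Nat.b2n (Nat.odd k)))).
  - apply recf_bsum; [easy|]; apply (H1 (ext C)); auto with recdb.
  - intros x; induction (F x) as [|n IH]; [easy|].
    simpl bsum; fold (bsum n (fun k => Nat.b2n (Nat.odd k))); rewrite <- IH.
    pose proof (Nat.div2_odd n); pose proof (Nat.div2_odd (S n)) as H2.
    rewrite Nat.odd_succ, <- Nat.negb_odd in H2; destruct (Nat.odd n); simpl Nat.b2n in *; lia.
Qed.

Definition query_ctx : ctx :=
  {| pt := (nat -> nat) * nat; orc := fst; vars := fun x => [snd x]; arity := 1;
     length_vars := fun _ => eq_refl |}.

(** [recf] demands a value at every point, while the search for the answer halts only if the odd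
    half of the oracle has a nonzero entry; hence the subset type. *)
Definition answer_ctx : ctx :=
  {| pt := {x : (nat -> nat) * nat | exists i, fst x (2 * i + 1) <> 0};
     orc := fun x => fst (proj1_sig x); vars := fun x => [snd (proj1_sig x)]; arity := 1;
     length_vars := fun _ => eq_refl |}.

Lemma pairseq_even p q n : pairseq p q (2 * n) = p n.
Proof. unfold pairseq; now rewrite Nat.even_even, Nat.div2_even. Qed.

Lemma pairseq_odd p q n : pairseq p q (2 * n + 1) = q n.
Proof. unfold pairseq; now rewrite Nat.even_odd, Nat.div2_odd'. Qed.

(** [seenU] belongs to the sequence [U'] witnessing semi-decidability; its factor switches it off in
    odd phases. *)
Definition layer_seen (seenW seenU : (nat -> nat) -> nat -> nat -> nat)
  (p : nat -> nat) (a n : nat) : nat :=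
  seenW p (Nat.div2 a) n + (1 - Nat.b2n (Nat.odd a)) * seenU p (Nat.div2 a) n.

Lemma comp_layer_seen seenW seenU :
  comp_functional seenW -> comp_functional seenU ->
  comp_functional (layer_seen seenW seenU).
Proof.
  intros HW HU C P F G HP HF HG; destruct (recf_div2_odd C F HF) as [H1 H2].
  unfold layer_seen; apply recf_add; [now apply HW|].
  apply recf_mul; [auto with recdb|now apply HU].
Qed.

Section Layers.
  Variables (W U' : nat -> cantor -> Prop) (A : cantor -> Prop).
  Variables (seenW seenU : (nat -> nat) -> nat -> nat -> nat).
  Variables (p : nat -> nat) (X : cantor).
  Hypothesis HW : ML_test W.
  Hypothesis HX : MLR X.
  Hypothesis HA : forall i X, ~ W i X -> (A X <-> U' i X).
  Hypothesis HseenW : forall i, (forall n, seenW p i n <> 0 -> W i X) /\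
    (W i X -> exists n0, forall n, n0 <= n -> seenW p i n <> 0).
  Hypothesis HseenU : forall i, (forall n, seenU p i n <> 0 -> U' i X) /\
    (U' i X -> exists n0, forall n, n0 <= n -> seenU p i n <> 0).
  Let a := phase (layer_seen seenW seenU p).

  Let O (b : nat) : Prop := W (Nat.div2 b) X \/ Nat.odd b = false /\ U' (Nat.div2 b) X.

  Lemma layer_seen_sound b n : layer_seen seenW seenU p b n <> 0 -> O b.
  Proof.
    unfold layer_seen, O; intros H.
    destruct (Nat.eq_dec (seenW p (Nat.div2 b) n) 0) as [E|E];
      [right|left; now apply HseenW in E].
    destruct (Nat.odd b); simpl in H; [lia|]; split; [easy|].
    apply HseenU with n; lia.
  Qed.

  Lemma layer_seen_complete b : O b ->
    exists n0, forall n, n0 <= n -> layer_seen seenW seenU p b n <> 0.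
  Proof.
    unfold layer_seen, O; intros [H|[-> H]].
    - apply HseenW in H; destruct H as [n0 H]; exists n0; intros n Hn.
      specialize (H n Hn); lia.
    - apply HseenU in H; destruct H as [n0 H]; exists n0; intros n Hn.
      specialize (H n Hn); simpl; lia.
  Qed.

  (** If [X] is outside [W j], then phase [2 * j + 1] is never left. *)
  Lemma layer_phase_stabilizes : exists N, forall n, N <= n -> a n = a N.
  Proof.
    assert (Hj : exists j, ~ W j X) by (apply not_all_ex_not, HX, HW).
    destruct Hj as [j Hj].
    apply (phase_stabilizes _ (fun _ => 0)) with (2 * j + 1); intros n.
    apply Nat.nlt_ge; intros Hlt.
    destruct (phase_passed _ (fun _ => 0) O layer_seen_sound n (2 * j + 1) Hlt)
      as [H|[H _]].
    - now rewrite Nat.div2_odd' in H.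
    - now rewrite Nat.odd_odd in H.
  Qed.

  (** With [j] half the final phase, [X] is outside [W j]. If the phase is odd, phase [2 * j] was
      left, so [X] is in [U' j]; if it is even, [X] is outside [U' j]. *)
  Lemma final_phase_parity N : (forall n, N <= n -> a n = a N) ->
    chi_MLR A X (Nat.b2n (Nat.odd (a N))).
  Proof.
    intros HN; split; [exact HX|].
    assert (Hout : ~ O (a N)).
    { intros H; apply layer_seen_complete in H; destruct H as [n0 H].
      specialize (H (max n0 N) ltac:(lia)).
      pose proof (HN (max n0 N) ltac:(lia)); pose proof (HN (S (max n0 N)) ltac:(lia)).
      destruct (phase_step (layer_seen seenW seenU p) (fun _ => 0) (max n0 N))
        as [[E _]|[_ [E _]]]; fold a in E; [|lia].
      now replace (a (max n0 N)) with (a N) in E by easy. }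
    unfold O in Hout; destruct (Nat.odd (a N)) eqn:Eo; [left|right]; split; try easy.
    - pose proof (Nat.div2_odd (a N)) as E; rewrite Eo in E; simpl Nat.b2n in E.
      apply HA with (Nat.div2 (a N)); [tauto|].
      destruct (phase_passed _ (fun _ => 0) O layer_seen_sound N (2 * Nat.div2 (a N)))
        as [H|[_ H]]; [fold a; lia| |]; rewrite Nat.div2_even in H; tauto.
    - rewrite HA; [|exact (fun H => Hout (or_introl H))]; tauto.
  Qed.
End Layers.

Theorem theorem6p1 (W U : nat -> cantor -> Prop) (A : cantor -> Prop) :
  universal_ML_test W -> universal_ML_test U -> layerwise_semidec W A ->
  weihrauch_le delta_MLR delta_nat (chi_MLR A) delta_MLR delta_nat (LAY U).
Proof.
  intros [HW _] HU [U' [HU' HA]].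
  destruct (universal_padding U HU) as [w [Hw Hpad]].
  destruct (unif_eff_open_seen W (proj1 HW)) as [seenW [HsW HseenW]].
  destruct (unif_eff_open_seen U' HU') as [seenU [HsU HseenU]].
  set (seen := layer_seen seenW seenU).
  assert (Hs : comp_functional seen) by now apply comp_layer_seen.
  assert (HPhi : recf query_ctx (fun x => padded (seen (fst x)) w (fst x) (snd x))).
  { apply (recf_app query_ctx (fun x => padded (seen (fst x)) w (fst x)) snd).
    - apply orecf_padded; [easy|easy|apply recf_orc].
    - apply (recf_nth query_ctx 0); simpl; lia. }
  set (P := fun (x : answer_ctx) k => fst (proj1_sig x) (2 * k)).
  (* The answer [i] is named by the characteristic function of [{i}], so it is the only index of a
     nonzero entry. *)
  set (M := fun x : answer_ctx => proj1_sig (least_nonzero _ (proj2_sig x))).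
  assert (HM : recf answer_ctx M).
  { apply (recf_mu answer_ctx (fun x i => fst (proj1_sig x) (2 * i + 1))).
    - apply (recf_app _ _ _ (recf_orc (ext answer_ctx))); auto with recdb.
    - intros x; unfold M; now destruct (least_nonzero _ _).
    - intros x; unfold M; now destruct (least_nonzero _ _). }
  assert (HPsi : recf answer_ctx (fun x => eqt (snd (proj1_sig x))
                   (Nat.b2n (Nat.odd (phase (seen (P x)) (M x)))))).
  { apply recf_eqt; [apply (recf_nth answer_ctx 0); simpl; lia|].
    apply recf_div2_odd, recf_phase; [easy| |exact HM].
    apply (recf_app _ _ _ (recf_orc (ext answer_ctx))); auto with recdb. }
  destruct HPhi as [Phi HPhi], HPsi as [Psi HPsi]; exists Phi, Psi.
  intros Gamma HG p X [HX Hp] _.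
  destruct (padded_bit (seen p) w p X Hp) as [X' HX'].
  destruct (layer_phase_stabilizes W U' seenW seenU p X HW HX (HseenW p X Hp) (HseenU p X Hp))
    as [N HN]; fold seen in HN.
  assert (HR : MLR X').
  { apply (MLR_prepend (start (seen p) w N) X X' HX); intros k.
    assert (E : b2n (X' (start (seen p) w N + k)) = b2n (X k))
      by (now rewrite <- HX', padded_tail, Hp).
    destruct (X' _), (X k); easy. }
  destruct (HG (padded (seen p) w p) X') as [q [Hq [i [Hqi [_ Hi]]]]].
  { now split. }
  { destruct (not_all_ex_not _ _ (HR U (proj1 HU))) as [i Hi]; now exists i. }
  (* A change at a stage [n >= i] would be followed by enough zeros to force [X'] into [U i]. *)
  assert (Hfin : forall n, i <= n -> phase (seen p) n = phase (seen p) i).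
  { intros n Hn; induction Hn as [|n Hn IH]; [easy|]; rewrite <- IH.
    apply NNPP; intros Hne; apply Hi.
    apply (Hpad n i (prefix X' n) Hn (length_prefix X' n)).
    intros k Hk; rewrite length_app, length_prefix, repeat_length in Hk.
    destruct (Nat.lt_ge_cases k n) as [L|L].
    - rewrite app_nth1 by (now rewrite length_prefix); now rewrite nth_prefix.
    - rewrite app_nth2, nth_repeat by (now rewrite length_prefix).
      pose proof (HX' k) as E; rewrite (padded_zero (seen p) w p n k Hne) in E by lia.
      now destruct (X' k). }
  set (v := Nat.b2n (Nat.odd (phase (seen p) i))).
  exists (fun m => eqt m v); split.
  - exists (padded (seen p) w p), q; split; [|split; [exact Hq|]].
    + intros n; exact (HPhi (p, n)).
    + intros m.
      assert (Hex : exists i, pairseq p q (2 * i + 1) <> 0).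
      { exists i; rewrite pairseq_odd, Hqi, Nat.eqb_refl; lia. }
      set (x := exist _ (pairseq p q, m) Hex : answer_ctx).
      assert (EM : M x = i).
      { unfold M; destruct (least_nonzero _ _) as [j [Hj Hmin]].
        change (pairseq p q (2 * j + 1) <> 0) in Hj; change (j = i).
        rewrite pairseq_odd, Hqi in Hj; now destruct (Nat.eqb_spec j i). }
      assert (EP : P x = p).
      (* [seen] takes the whole input as its argument, so pointwise agreement must become
         equality. *)
      { apply functional_extensionality; intros k; apply pairseq_even. }
      specialize (HPsi x); now rewrite EM, EP in HPsi.
  - exists v; split.
    + intros m; unfold eqt; destruct (Nat.eqb_spec m v); lia.
    + now apply (final_phase_parity W U' A seenW seenU p X HX HA (HseenW p X Hp)
        (HseenU p X Hp)).
Qed.
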